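(* Let $p$ be a Wolstenholme prime. Then $$\binom{2p-1}{p-1} \equiv 1 + p\sum_{k=1}^{p-1}\frac{1}{k} - \frac{p^2}{2}\sum_{k=1}^{p-1}\frac{1}{k^2} + \frac{p^3}{3}\sum_{k=1}^{p-1}\frac{1}{k^3} - \frac{p^4}{4}\sum_{k=1}^{p-1}\frac{1}{k^4} + \frac{p^5}{5}\sum_{k=1}^{p-1}\frac{1}{k^5} - \frac{p^6}{6}\sum_{k=1}^{p-1}\frac{1}{k^6} \pmod{p^8}.$$
   Context: A prime $p$ is called a Wolstenholme prime if $\binom{2p-1}{p-1}\equiv 1 \pmod{p^4}$. Congruences between rational numbers modulo $p^e$ are understood in the ring of rationals with denominator prime to $p$: $a\equiv b \pmod{p^e}$ means that $a-b$, written in reduced form, has numerator divisible by $p^e$ and denominator prime to $p$. *)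

(* Defs.v *)
From mathcomp Require Import all_boot all_order all_algebra.

Set Implicit Arguments.
Unset Strict Implicit.
Unset Printing Implicit Defensive.

Import GRing.Theory Num.Theory.
Local Open Scope ring_scope.

Definition wolstenholme_prime (p : nat) : Prop :=
  prime p /\ 'C(2 * p - 1, p - 1) = 1 %[mod p ^ 4].

(* [numq] and [denq] are the numerator and denominator in lowest terms. *)
Definition eqq_mod (p e : nat) (a b : rat) : Prop :=
  ((p ^ e)%N%:Z %| numq (a - b))%Z /\ coprimez (denq (a - b)) p%:Z.

Definition power_harmonic (p j : nat) : rat :=
  \sum_(1 <= k < p) 1 / k%:R ^+ j.

(* Main.v *)
From HB Require Import structures.
Require Import Defs.
From mathcomp Require Import all_boot all_order all_algebra.
From mathcomp Require Import ring.

(** The binomial coefficient C = 'C(2 * p - 1, p - 1) is the product of the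
    1 + p / k for 0 < k < p ([bin_prod]).  Taking p-adic logarithms,
      log C = \sum_(0 < k < p) log (1 + p / k)
            = p H_1 - p ^ 2 / 2 H_2 + p ^ 3 / 3 H_3 - ...,
    where H_j is [power_harmonic p j].  For a Wolstenholme prime, C = 1 + x with
    x divisible by p ^ 4, so log C = x - x ^ 2 / 2 + ... is x modulo p ^ 8.  On
    the right-hand side, the terms of degree at least 8 vanish modulo p ^ 8,
    and so does p ^ 7 / 7 H_7, because p divides H_7 ([power_harmonic_odd]).

    No p-adic analysis is required: the logarithm is replaced by its truncation
    [trunc_log 7], a polynomial whose denominators are prime to p since p > 7
    ([wolstenholme_gt7]).  It is additive modulo 'X^8 on multiples of 'X
    ([trunc_logD], proved by differentiation).  This is applied to the factors
    1 + 'X / k, and evaluation at 'X = p turns 'X^8 into p ^ 8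
    ([trunc_log_prod_mod]). *)

Set Implicit Arguments.
Unset Strict Implicit.
Unset Printing Implicit Defensive.

Import GRing.Theory Num.Theory.
Local Open Scope ring_scope.

(** * The truncated logarithm *)

(** The truncation at degree n of the power series log (1 + X). *)
Definition trunc_log (F : numFieldType) (n : nat) : {poly F} :=
  \sum_(j < n) ((-1) ^+ j / j.+1%:R) *: 'X^(j.+1).
Arguments trunc_log {F} n.

(** The truncated form of log' (1 + X) = 1 / (1 + X): a geometric sum. *)
Lemma deriv_trunc_log (F : numFieldType) n :
  (1 + 'X) * (trunc_log n)^`() = 1 - (- 'X) ^+ n :> {poly F}.
Proof.
have -> : (trunc_log n)^`() = \sum_(j < n) (- 'X) ^+ j :> {poly F}.
  rewrite linear_sum; apply: eq_bigr => j _.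
  rewrite /= derivZ derivXn -scaler_nat scalerA divfK ?pnatr_eq0 //.
  by rewrite -[- 'X]scaleN1r exprZn.
rewrite -[X in 1 + X]opprK -[X in _ = X - _](expr1n _ n) subrXX; congr (_ * _).
by apply: eq_bigr => j _; rewrite expr1n mul1r.
Qed.

Lemma dvdp_X_root0 (F : fieldType) (f : {poly F}) : ('X %| f) = root f 0.
Proof. by rewrite -dvdp_XsubCl polyC0 subr0. Qed.

(** Formal integration gains one order of vanishing; characteristic 0 is what
    makes the derivative determine the coefficients of positive degree. *)
Lemma dvdp_Xn_deriv (F : numFieldType) n (f : {poly F}) :
  root f 0 -> 'X^n %| f^`() -> 'X^(n.+1) %| f.
Proof.
rewrite -dvdp_X_root0 => /dvdpP[h Dh] /dvdpP[g Dg].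
suff f0 : take_poly n.+1 f = 0.
  by rewrite -(poly_take_drop n.+1 f) f0 add0r dvdp_mull.
apply/polyP => -[|i]; rewrite coef_take_poly coef0; first by rewrite Dh coefMX.
rewrite ltnS; case: ltnP => // lt_in.
have := coef_deriv f i; rewrite Dg coefMXn lt_in => /esym/eqP.
by rewrite mulrn_eq0 => /eqP.
Qed.

Lemma coprimep_XnD1 (F : fieldType) n (c : {poly F}) :
  'X %| c -> coprimep 'X^n (1 + c).
Proof.
rewrite dvdp_X_root0 => c0; apply: coprimep_expl; rewrite coprimep_sym coprimepX.
by rewrite rootE hornerD (rootP c0) hornerC addr0 oner_eq0.
Qed.

Lemma trunc_log_at0 (F : numFieldType) n : (trunc_log n).[0] = 0 :> F.
Proof.
rewrite /trunc_log horner_sum big1 // => j _.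
by rewrite hornerZ hornerXn expr0n mulr0.
Qed.

(** The functional equation of the logarithm survives truncation.  Both sides
    vanish at 0, so it is enough to compare derivatives modulo 'X^n.  Multiplied
    by (1 + a) * (1 + b), which is prime to 'X^n, both derivatives become the
    derivative of (1 + a) * (1 + b), up to multiples of the n-th powers of a, b
    and w = (1 + a) * (1 + b) - 1, hence of 'X^n. *)
Lemma trunc_logD (F : numFieldType) n (a b : {poly F}) : 'X %| a -> 'X %| b ->
  'X^(n.+1) %| (trunc_log n \Po ((1 + a) * (1 + b) - 1))
             - ((trunc_log n \Po a) + (trunc_log n \Po b)).
Proof.
move=> Xa Xb; set w := (1 + a) * (1 + b) - 1.
have Ew : w = a * (1 + b) + b by rewrite /w; ring.
have Xw : 'X %| w by rewrite Ew dvdp_add ?dvdp_mulr.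
have D (c : {poly F}) :
    (1 + c) * (trunc_log n \Po c)^`() = (1 - (- c) ^+ n) * c^`().
  rewrite deriv_comp mulrA; congr (_ * _).
  have /(congr1 (comp_poly c)) := deriv_trunc_log F n.
  rewrite comp_polyM comp_polyB comp_polyD !comp_polyC comp_polyX => ->.
  by rewrite -!scaleN1r !exprZn comp_polyZ comp_Xn_poly.
apply: dvdp_Xn_deriv.
  rewrite -dvdp_X_root0.
  have X0 (c : {poly F}) : 'X %| c -> 'X %| trunc_log n \Po c.
    rewrite !dvdp_X_root0 => /rootP c0.
    by rewrite rootE horner_comp c0 trunc_log_at0.
  by apply: dvdp_sub; [exact: X0|apply: dvdp_add; exact: X0].
have Xn (c : {poly F}) : 'X %| c -> 'X^n %| (- c) ^+ n.
  by move=> Xc; rewrite dvdp_exp2r // dvdpNr.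
have Dw : w^`() = (1 + b) * a^`() + (1 + a) * b^`().
  by rewrite /w derivB derivM !derivD -polyC1 derivC; ring.
rewrite -(Gauss_dvdpr _ (coprimep_XnD1 _ Xw)) derivB derivD mulrBr D.
have -> : (1 + w) * ((trunc_log n \Po a)^`() + (trunc_log n \Po b)^`()) =
    (1 + b) * ((1 + a) * (trunc_log n \Po a)^`()) +
    (1 + a) * ((1 + b) * (trunc_log n \Po b)^`()) by rewrite /w; ring.
rewrite !D Dw.
set A := (- a) ^+ n; set B := (- b) ^+ n; set W := (- w) ^+ n.
have -> : (1 - W) * ((1 + b) * a^`() + (1 + a) * b^`()) -
    ((1 + b) * ((1 - A) * a^`()) + (1 + a) * ((1 - B) * b^`())) =
    A * ((1 + b) * a^`()) + B * ((1 + a) * b^`()) -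
    W * ((1 + b) * a^`() + (1 + a) * b^`()) by ring.
by rewrite dvdp_sub ?dvdp_add // dvdp_mulr ?Xn.
Qed.

Lemma trunc_log_prod (F : numFieldType) (I : Type) n (r : seq I)
    (a : I -> {poly F}) :
  (forall i, 'X %| a i) ->
  'X^(n.+1) %| (trunc_log n \Po (\prod_(i <- r) (1 + a i) - 1))
             - \sum_(i <- r) (trunc_log n \Po a i).
Proof.
move=> Xa; elim: r => [|i r IHr].
  by rewrite !big_nil subrr subr0 comp_polyCr trunc_log_at0 dvdp0.
rewrite !big_cons; set P := \prod_(i <- r) _ in IHr *.
have XP : 'X %| P - 1.
  rewrite /P; elim: (r) => [|j s IHs]; first by rewrite big_nil subrr dvdp0.
  rewrite big_cons mulrDl mul1r addrAC dvdp_add // dvdp_mulr //.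
have := dvdp_add (trunc_logD _ (Xa i) XP) IHr.
rewrite [1 + (P - 1)]addrC subrK.
by congr (is_true (_ %| _)); ring.
Qed.

(** * Rationals with denominator prime to p *)

(** The localization of the integers at p, as a subset of the rationals; a
    congruence modulo p ^ e is the membership of the difference divided by
    p ^ e.  The reduced denominator makes this literally one half of
    [eqq_mod]. *)
Definition plocal (p : nat) : {pred rat} := [pred x | coprimez (denq x) p%:Z].

(** Any denominator prime to p may serve, reduced or not; this is the form in
    which stability under the ring operations is plain. *)
Lemma plocalP (p : nat) (x : rat) :
  reflect (exists2 d : int, coprimez d p%:Z & x * d%:~R \is a Num.int)
    (x \in plocal p).
Proof.
apply: (iffP idP) => [px|[d dp /intrP[m Dm]]].
  by exists (denq x) => //; rewrite -numqE intr_int.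
rewrite inE; apply: coprimez_dvdl dp.
have : m * denq x = numq x * d.
  by apply: (@intr_inj rat); rewrite !rmorphM /= -Dm numqE; ring.
move/(congr1 (fun z => denq x %| z)%Z); rewrite dvdz_mull ?dvdzz //.
by rewrite Gauss_dvdzr // coprimez_sym /coprimez; have := coprime_num_den x.
Qed.

Fact plocal_subring p : subring_closed (plocal p).
Proof.
have num1 : coprimez 1 p%:Z by rewrite coprimezE coprime1n.
split=> [|x y /plocalP[d dp xd] /plocalP[e ep ye]
         |x y /plocalP[d dp xd] /plocalP[e ep ye]].
- by apply/plocalP; exists 1; rewrite ?mulr1 ?rpred1.
- apply/plocalP; exists (d * e); first by rewrite coprimezMl dp.
  have -> : (x - y) * (d * e)%:~R = (x * d%:~R) * e%:~R - (y * e%:~R) * d%:~R.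
    by rewrite intrM; ring.
  by apply: rpredB; apply: rpredM => //; apply: intr_int.
- apply/plocalP; exists (d * e); first by rewrite coprimezMl dp.
  by rewrite intrM mulrACA rpredM.
Qed.
HB.instance Definition _ p :=
  GRing.isSubringClosed.Build rat (plocal p) (plocal_subring p).

Lemma plocal_natV p k : prime p -> (0 < k < p)%N -> k%:R^-1 \in plocal p.
Proof.
move=> p_pr /andP[k_gt0 lt_kp]; apply/plocalP; exists k%:Z.
  by rewrite coprimezE coprime_sym prime_coprime // gtnNdvd.
by rewrite mulVf ?rpred1 // pnatr_eq0 -lt0n.
Qed.

Lemma eqq_mod_plocal p e a b : prime p ->
  (a - b) / p%:R ^+ e \in plocal p -> eqq_mod p e a b.
Proof.
move=> p_pr; set x := a - b => xp.
have p0 : (p%:R : rat) != 0 by rewrite pnatr_eq0 -lt0n prime_gt0.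
have Dx : x = p%:R ^+ e * (x / p%:R ^+ e) by rewrite mulrC divfK ?expf_neq0.
split; last by change (x \in plocal p); rewrite Dx rpredM ?rpredX ?rpred_nat.
have /plocalP[d dp /intrP[m Dm]] := xp.
have : numq x * d = (p ^ e)%N%:Z * (m * denq x).
  apply: (@intr_inj rat); rewrite !rmorphM /= numqE -Dm -pmulrn natrX.
  by rewrite {1}Dx; ring.
move=> Dnum; have : ((p ^ e)%N%:Z %| numq x * d)%Z by rewrite Dnum dvdz_mulr.
have pe_d : coprimez (p ^ e)%N d by rewrite coprimezE coprimeXl // coprime_sym.
by rewrite Gauss_dvdzl.
Qed.

(** * Congruences for the truncated logarithm *)

Lemma trunc_log_plocal p n : prime p -> (n < p)%N ->
  trunc_log n \is a polyOver (plocal p).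
Proof.
move=> p_pr lt_np; apply: rpred_sum => j _.
rewrite polyOverZ ?polyOverXn // rpredM ?rpredX ?rpredN ?rpred1 //.
by rewrite plocal_natV //= (leq_ltn_trans (ltn_ord j)).
Qed.

(** The polynomial congruence [trunc_log_prod] for the factors 1 + 'X / k,
    evaluated at 'X = p.  All coefficients lie in [plocal p], hence so do those
    of the quotient by 'X^(n.+1), which are among them; its value at p is thus
    in [plocal p]. *)
Lemma trunc_log_prod_mod p n : prime p -> (n < p)%N ->
  ((trunc_log n).[\prod_(1 <= k < p) (1 + p%:R / k%:R) - 1]
    - \sum_(1 <= k < p) (trunc_log n).[p%:R / k%:R]) / p%:R ^+ n.+1
    \in plocal p.
Proof.
move=> p_pr lt_np; pose a k : {poly rat} := k%:R^-1 *: 'X.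
have Xa k : 'X %| a k by rewrite /a -mul_polyC dvdp_mull.
have := trunc_log_prod n (index_iota 1 p) Xa.
set F := _ - _ => /dvdpP[g Dg].
have ea k : (a k).[p%:R] = p%:R / k%:R by rewrite hornerZ hornerX mulrC.
have -> : (trunc_log n).[\prod_(1 <= k < p) (1 + p%:R / k%:R) - 1]
    - \sum_(1 <= k < p) (trunc_log n).[p%:R / k%:R] = F.[p%:R].
  rewrite /F hornerD hornerN horner_comp hornerD hornerN hornerC horner_prod.
  rewrite [(\sum_(1 <= _ < _) _).[_]]horner_sum.
  under [in RHS]eq_bigr do rewrite hornerD hornerC ea.
  by under [X in _ = _ - X]eq_bigr do rewrite horner_comp ea.
have aZ k : k \in index_iota 1 p -> a k \is a polyOver (plocal p).
  by rewrite mem_index_iota => k_p; rewrite polyOverZ ?polyOverX ?plocal_natV.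
have FZ : F \is a polyOver (plocal p).
  rewrite /F rpredB //.
    rewrite polyOver_comp ?trunc_log_plocal // rpredB ?rpred1 //.
    by rewrite big_seq rpred_prod // => k k_p; rewrite rpredD ?rpred1 ?aZ.
  rewrite big_seq rpred_sum // => k k_p.
  by rewrite polyOver_comp ?trunc_log_plocal ?aZ.
have -> : F.[p%:R] / p%:R ^+ n.+1 = g.[p%:R].
  rewrite Dg hornerM hornerXn mulfK // expf_neq0 //.
  by rewrite pnatr_eq0 -lt0n prime_gt0.
have -> : g = drop_poly n.+1 F by rewrite Dg drop_polyMXn_id.
rewrite rpred_horner ?rpred_nat //; apply/polyOverP => i.
by rewrite coef_drop_poly (polyOverP FZ).
Qed.

(** Every term of log (1 + x) but the first is divisible by x ^+ 2, and its
    denominator is prime to p. *)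
Lemma trunc_log_linear p n e x : prime p -> (n < p)%N -> (0 < n)%N ->
  x / p%:R ^+ e \in plocal p ->
  ((trunc_log n).[x] - x) / p%:R ^+ (2 * e) \in plocal p.
Proof.
case: n => // n p_pr lt_np _ xp.
have p0 : (p%:R ^+ e : rat) != 0.
  by rewrite expf_neq0 // pnatr_eq0 -lt0n prime_gt0.
have xZ : x \in plocal p by rewrite -(divfK p0 x) rpredM ?rpredX ?rpred_nat.
rewrite /trunc_log big_ord_recl hornerD hornerZ hornerX expr0 divr1 mul1r.
rewrite addrC addKr horner_sum mulr_suml; apply: rpred_sum => j _.
rewrite hornerZ hornerXn lift0.
have -> : (-1) ^+ j.+1 / j.+2%:R * x ^+ j.+2 / p%:R ^+ (2 * e) =
    (-1) ^+ j.+1 / j.+2%:R * x ^+ j * (x / p%:R ^+ e) ^+ 2.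
  rewrite mulnC exprM !exprS; field.
  by rewrite p0 -natrD pnatr_eq0.
rewrite rpredM ?(rpredX _ xp) // !rpredM ?rpredX ?rpredN ?rpred1 ?plocal_natV //=.
by apply: leq_ltn_trans lt_np; rewrite ltnS.
Qed.

(** * Power harmonic sums and the binomial coefficient *)

Lemma trunc_log_harmonic p n :
  \sum_(1 <= k < p) (trunc_log n).[p%:R / k%:R] =
  \sum_(j < n) (-1) ^+ j * p%:R ^+ j.+1 / j.+1%:R * power_harmonic p j.+1.
Proof.
under eq_bigr do rewrite horner_sum.
rewrite exchange_big; apply: eq_bigr => j _ /=.
rewrite mulr_sumr; apply: eq_bigr => k _.
by rewrite hornerZ hornerXn expr_div_n; ring.
Qed.

(** Pair k with p - k: the inverses x and y satisfy x + y = p * (x * y), and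
    x + y divides x ^+ m + y ^+ m for odd m. *)
Lemma power_harmonic_odd p m : prime p -> odd p -> odd m ->
  power_harmonic p m / p%:R \in plocal p.
Proof.
move=> p_pr p_odd m_odd.
have p0 : (p%:R : rat) != 0 by rewrite pnatr_eq0 -lt0n prime_gt0.
have p_gt2 : (2 < p)%N by rewrite odd_prime_gt2.
suff H2 : 2%:R * power_harmonic p m / p%:R \in plocal p.
  have -> : power_harmonic p m / p%:R =
      2%:R^-1 * (2%:R * power_harmonic p m / p%:R).
    by field.
  by rewrite rpredM ?plocal_natV.
have -> : 2%:R * power_harmonic p m =
    \sum_(1 <= k < p) (k%:R^-1 ^+ m + (p - k)%:R^-1 ^+ m).
  rewrite big_split /= mulr_natl mulr2n; congr (_ + _).
    by apply: eq_bigr => k _; rewrite div1r exprVn.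
  rewrite /power_harmonic big_nat_rev /= add1n.
  by apply: eq_bigr => k _; rewrite subSS div1r exprVn.
rewrite mulr_suml big_seq; apply: rpred_sum => k.
rewrite mem_index_iota => k_p; have /andP[k_gt0 lt_kp] := k_p.
have pk_p : (0 < p - k < p)%N.
  by rewrite subn_gt0 lt_kp ltn_subrL k_gt0 prime_gt0.
set x := k%:R^-1; set y := (p - k)%:R^-1.
have [xZ yZ] : x \in plocal p /\ y \in plocal p by rewrite !plocal_natV.
have -> : x ^+ m + y ^+ m = x ^+ m - (- y) ^+ m.
  by rewrite exprNn -signr_odd m_odd expr1 mulN1r opprK.
have Exy : x + y = p%:R * (x * y).
  have /andP[pk_gt0 _] := pk_p.
  rewrite /x /y -[in RHS](subnK (ltnW lt_kp)) natrD addnK.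
  have : (k%:R : rat) != 0 by rewrite pnatr_eq0 -lt0n.
  have : ((p - k)%:R : rat) != 0 by rewrite pnatr_eq0 -lt0n.
  by move: (p - k)%:R k%:R => u v u0 v0; field; rewrite u0.
rewrite subrXX opprK Exy mulrC !mulrA mulVf // mul1r.
rewrite !rpredM //; apply: rpred_sum => i _.
by rewrite rpredM ?rpredX ?rpredN.
Qed.

Lemma bin_prod p m :
  'C(p + m, m)%:R = \prod_(1 <= k < m.+1) (1 + p%:R / k%:R) :> rat.
Proof.
elim: m => [|m IHm]; first by rewrite bin0 big_geq.
rewrite big_nat_recr //= -IHm.
have m0 : (m.+1%:R : rat) != 0 by rewrite pnatr_eq0.
apply: (mulfI m0); rewrite -natrM -mul_bin_diag addnS /= natrM -addnS natrD.
by move: m.+1%:R m0 => c c0; field.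
Qed.

(** Small primes fail by computation; for the others, the denominators 2, ..., 7
    of the truncated logarithm of degree 7 are prime to p. *)
Lemma wolstenholme_gt7 p : wolstenholme_prime p -> (7 < p)%N.
Proof.
case=> p_pr Cp; rewrite ltnNge; apply/negP => le_p7; move: p_pr Cp.
by do 8 (case: p le_p7 => [|p] le_p7; first by move=> // _; vm_compute).
Qed.

Theorem proposition1 (p : nat) (hp : wolstenholme_prime p) :
  eqq_mod p 8
    ('C(2 * p - 1, p - 1)%:R)
    (1 + p%:R * power_harmonic p 1
       - p%:R ^+ 2 / 2%:R * power_harmonic p 2
       + p%:R ^+ 3 / 3%:R * power_harmonic p 3
       - p%:R ^+ 4 / 4%:R * power_harmonic p 4
       + p%:R ^+ 5 / 5%:R * power_harmonic p 5
       - p%:R ^+ 6 / 6%:R * power_harmonic p 6).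
Proof.
have p_gt7 := wolstenholme_gt7 hp; have [p_pr Cp] := hp.
have p0 : (p%:R : rat) != 0 by rewrite pnatr_eq0 -lt0n prime_gt0.
apply: eqq_mod_plocal => //.
set C := 'C(_, _) in Cp *; set x : rat := C%:R - 1.
have DC : C%:R = \prod_(1 <= k < p) (1 + p%:R / k%:R) :> rat.
  have -> : C = 'C(p + p.-1, p.-1).
    by rewrite /C -subn1 mul2n -addnn addnBA ?prime_gt0.
  by rewrite bin_prod prednK ?prime_gt0.
have xp : x / p%:R ^+ 4 \in plocal p.
  have C_gt0 : (0 < C)%N by rewrite bin_gt0 leq_sub2r // mul2n -addnn leq_addr.
  have /dvdnP[m Dm] : (p ^ 4 %| C - 1)%N by rewrite -eqn_mod_dvd // Cp.
  by rewrite /x -(natrB _ C_gt0) Dm natrM natrX mulfK ?expf_neq0 ?rpred_nat.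
have log_x := trunc_log_linear p_pr p_gt7 isT xp.
have := trunc_log_prod_mod p_pr p_gt7.
rewrite -DC -/x trunc_log_harmonic !big_ord_recl big_ord0 => log_C.
have p_odd : odd p by case: (even_prime p_pr) p_gt7 => [->|].
have H7 := power_harmonic_odd p_pr p_odd (isT : odd 7).
set T := (X in C%:R - X).
set L := (X in _.[x] - X) in log_C.
(* log (1 + x) agrees modulo p ^ 8 with x on one hand and with L on the other;
   L exceeds T - 1 by the term of degree 7, which H7 controls. *)
have -> : (C%:R - T) / p%:R ^+ 8 =
    ((trunc_log 7).[x] - L) / p%:R ^+ 8
    - ((trunc_log 7).[x] - x) / p%:R ^+ (2 * 4)
    + 7%:R^-1 * (power_harmonic p 7 / p%:R).
  have -> : L = T - 1 + p%:R ^+ 7 / 7%:R * power_harmonic p 7.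
    by rewrite /L /T /= /bump !leq0n !add1n; field.
  by rewrite /x; move: (trunc_log 7).[_] => l; field.
by rewrite rpredD ?rpredB // rpredM ?plocal_natV.
Qed.
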